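(* Suppose there exist a diagonal matrix $D\in\mathbb{R}^{r\times r}$ with $D>0$, matrices $P\in\mathbb{R}^{r\times r}$ with $P>0$, $Q\in\mathbb{R}^{p\times p}$ with $Q>0$, $X\in\mathbb{R}^{r\times r}$ with $X>0$, and a matrix $S\in\mathbb{R}^{m\times r}$ such that all of the following hold: 1) $PA^{\mathrm T}+AP-2\,\mathrm{Re}(\lambda_2)PC^{\mathrm T}QCX-2\,\mathrm{Re}(\lambda_2)XC^{\mathrm T}QCP+2\,\mathrm{Re}(\lambda_2)XC^{\mathrm T}QCX<0$; 2) $A-l_{\max}PC^{\mathrm T}QC$ is Metzler; 3) $PC^{\mathrm T}QC\succeq0$; 4) $BS\succeq0$; 5) $AD-BS$ is Metzler; 6) $AD-BS+DA^{\mathrm T}-S^{\mathrm T}B^{\mathrm T}<0$. Then Problem PCDMAS (as defined in the context, for the data $A,B,C,\mathcal{G}$) is solvable, and it is solved by the gain matrices $K=SD^{-1}$ and $L=PC^{\mathrm T}Q$.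
   Context: Notation. For a real matrix or vector $M$, $M\succeq 0$ means all entries are non-negative. For a real symmetric matrix $M$, $M>0$ (resp. $M<0$) means $M$ is positive definite (resp. negative definite). A real square matrix is Metzler if all its off-diagonal entries are non-negative. Graph. $\mathcal{G}=(\mathcal{V},\mathcal{E})$ is a directed graph with vertices $v_1,\dots,v_n$, $n\ge 2$, without self-loops, which has a spanning tree, i.e. there is a node from which there is a directed path to every other node. Its adjacency matrix $\mathcal{A}\in\mathbb{R}^{n\times n}$ has $[\mathcal{A}]_{ij}=1$ if $(v_j,v_i)\in\mathcal{E}$ (a directed edge from $v_j$ to $v_i$) and $[\mathcal{A}]_{ij}=0$ otherwise. The Laplacian $\mathcal{L}$ is defined by $[\mathcal{L}]_{ii}=\sum_{j}[\mathcal{A}]_{ij}$ and $[\mathcal{L}]_{ij}=-[\mathcal{A}]_{ij}$ for $i\ne j$. Put $l_{\max}=\max_i[\mathcal{L}]_{ii}$. The eigenvalues of $\mathcal{L}$ (with multiplicity, possibly complex) are ordered as $0=\lambda_1<\mathrm{Re}(\lambda_2)\le\dots\le\mathrm{Re}(\lambda_n)$. Agents. $A\in\mathbb{R}^{r\times r}$ is Metzler, $B\in\mathbb{R}^{r\times m}$ and $C\in\mathbb{R}^{p\times r}$ satisfy $B\succeq 0$, $C\succeq 0$, and $(A,B,C)$ is stabilizable and detectable. For $i=1,\dots,n$, agent $i$ has dynamics $\dot x_i=Ax_i+Bu_i$, $y_i=Cx_i$, and uses the observer-type dynamic output-feedback protocol $\dot{\hat x}_i=A\hat x_i+LC\sum_{j}[\mathcal{A}]_{ij}(e_i-e_j)+Bu_i$,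 $u_i=-K\hat x_i$, where $e_i:=x_i-\hat x_i$ and $K\in\mathbb{R}^{m\times r}$, $L\in\mathbb{R}^{r\times p}$ are gain matrices to be designed. With $\tilde x_i=[x_i^{\mathrm T},e_i^{\mathrm T}]^{\mathrm T}\in\mathbb{R}^{2r}$ the augmented closed-loop system is $$\dot{\tilde x}_i=\tilde A\tilde x_i+\tilde B L\tilde C\sum_{j=1}^n[\mathcal{A}]_{ij}(\tilde x_j-\tilde x_i),\quad i=1,\dots,n,$$ $$\tilde A=\begin{bmatrix}A-BK&BK\\ 0&A\end{bmatrix},\quad \tilde B=\begin{bmatrix}0\\ I\end{bmatrix},\quad \tilde C=\begin{bmatrix}0&C\end{bmatrix}.$$ Problem PCDMAS (Positive Consensus of Directed Multi-agent Systems). Design $K$ and $L$ such that for all non-negative initial values ($\tilde x_i(0)\succeq0$ for all $i$), the solution of the augmented closed-loop system satisfies $\lim_{t\to\infty}(\tilde x_j(t)-\tilde x_i(t))=0$ for all $i,j\in\{1,\dots,n\}$, and $\tilde x_i(t)\succeq 0$ for all $t\ge0$ and all $i$. The problem is solvable if such $K,L$ exist; such a pair $K,L$ is said to solve it. *)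

(* Defs.v *)
From mathcomp Require Import all_boot all_order all_algebra.
From mathcomp Require Import all_classical all_reals all_analysis.
From mathcomp Require Import complex.

Set Implicit Arguments.
Unset Strict Implicit.
Unset Printing Implicit Defensive.

Import Order.TTheory GRing.Theory Num.Theory.
Import numFieldNormedType.Exports.

Local Open Scope classical_set_scope.
Local Open Scope ring_scope.

Definition nonneg_mx (R : realType) (m n : nat) (M : 'M[R]_(m, n)) : Prop :=
  forall i j, 0 <= M i j.

Definition metzler (R : realType) (n : nat) (M : 'M[R]_n) : Prop :=
  forall i j, i != j -> 0 <= M i j.

(* Symmetry is part of definiteness. *)
Definition posdef (R : realType) (n : nat) (M : 'M[R]_n) : Prop :=
  M^T = M /\ forall v : 'cV[R]_n, v != 0 -> 0 < (v^T *m M *m v) 0 0.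

Definition negdef (R : realType) (n : nat) (M : 'M[R]_n) : Prop :=
  M^T = M /\ forall v : 'cV[R]_n, v != 0 -> (v^T *m M *m v) 0 0 < 0.

Definition complex_mx (R : realType) (n : nat) (M : 'M[R]_n) : 'M[R[i]]_n :=
  map_mx (real_complex R) M.

Definition hurwitz (R : realType) (n : nat) (M : 'M[R]_n) : Prop :=
  forall z : R[i], eigenvalue (complex_mx M) z -> complex.Re z < 0.

Definition stabilizable (R : realType) (r m : nat)
    (A : 'M[R]_r) (B : 'M[R]_(r, m)) : Prop :=
  exists F : 'M[R]_(m, r), hurwitz (A - B *m F).

Definition detectable (R : realType) (r p : nat)
    (A : 'M[R]_r) (C : 'M[R]_(p, r)) : Prop :=
  exists G : 'M[R]_(r, p), hurwitz (A - G *m C).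

(* The complex eigenvalues of a real matrix, repeated according to their
   algebraic multiplicity and sorted by nondecreasing real part. *)
Definition spectrum (R : realType) (n : nat) (M : 'M[R]_n) : seq R[i] :=
  sort (fun z w : R[i] => complex.Re z <= complex.Re w)
    (sval (closed_field_poly_normal (char_poly (complex_mx M)))).

(* A directed graph on 'I_n is given by its edge relation, E j i meaning that
   there is an edge from j to i. *)
Definition has_spanning_tree (n : nat) (E : rel 'I_n) : Prop :=
  exists root : 'I_n, forall i : 'I_n, connect E root i.

Definition adjacency (R : realType) (n : nat) (E : rel 'I_n) : 'M[R]_n :=
  \matrix_(i, j) (E j i)%:R.

Definition laplacian (R : realType) (n : nat) (E : rel 'I_n) : 'M[R]_n :=
  \matrix_(i, j) if i == j then \sum_k adjacency R E i k
                 else - adjacency R E i j.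

(* The default value 0 is harmless, the diagonal entries being nonnegative. *)
Definition lmax (R : realType) (n : nat) (E : rel 'I_n) : R :=
  \big[Num.max/0]_i laplacian R E i i.

(* Real part of the second eigenvalue (index 1, counting from 0). When the graph
   has a spanning tree, index 0 is the simple eigenvalue 0. *)
Definition re_lambda2 (R : realType) (n : nat) (E : rel 'I_n) : R :=
  complex.Re (nth 0 (spectrum (laplacian R E)) 1).

Definition aug_A (R : realType) (r m : nat) (A : 'M[R]_r) (B : 'M[R]_(r, m))
    (K : 'M[R]_(m, r)) : 'M[R]_(r + r) :=
  block_mx (A - B *m K) (B *m K) 0 A.

Definition aug_B (R : realType) (r : nat) : 'M[R]_(r + r, r) :=
  col_mx 0 1%:M.

Definition aug_C (R : realType) (r p : nat) (C : 'M[R]_(p, r)) :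
    'M[R]_(p, r + r) :=
  row_mx 0 C.

(* Trajectories on [0, +oo[: x i t stacks the state x_i(t) of agent i over its
   observation error e_i(t). The differential equation is imposed for t > 0,
   with continuity up to t = 0; the right derivative at 0 then exists and
   satisfies it too. *)
Definition closed_loop_solution (R : realType) (n r m p : nat) (E : rel 'I_n)
    (A : 'M[R]_r) (B : 'M[R]_(r, m)) (C : 'M[R]_(p, r))
    (K : 'M[R]_(m, r)) (L : 'M[R]_(r, p))
    (x : 'I_n -> R -> 'cV[R]_(r + r)) : Prop :=
  forall i : 'I_n,
    {within [set t : R | 0 <= t], continuous (x i)} /\
    forall t : R, 0 < t ->
      is_derive t (1 : R) (x i)
        (aug_A A B K *m x i t
         + aug_B R r *m L *m aug_C C *m
             \sum_(j < n) adjacency R E i j *: (x j t - x i t)).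

Definition solves_PCDMAS (R : realType) (n r m p : nat) (E : rel 'I_n)
    (A : 'M[R]_r) (B : 'M[R]_(r, m)) (C : 'M[R]_(p, r))
    (K : 'M[R]_(m, r)) (L : 'M[R]_(r, p)) : Prop :=
  forall x : 'I_n -> R -> 'cV[R]_(r + r),
    closed_loop_solution E A B C K L x ->
    (forall i, nonneg_mx (x i 0)) ->
    (forall i j, x j t - x i t @[t --> +oo] --> (0 : 'cV[R]_(r + r))) /\
    (forall t : R, 0 <= t -> forall i, nonneg_mx (x i t)).

Definition PCDMAS_solvable (R : realType) (n r m p : nat) (E : rel 'I_n)
    (A : 'M[R]_r) (B : 'M[R]_(r, m)) (C : 'M[R]_(p, r)) : Prop :=
  exists (K : 'M[R]_(m, r)) (L : 'M[R]_(r, p)), solves_PCDMAS E A B C K L.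

(* Main.v *)
Require Import Defs.
From mathcomp Require Import all_boot all_order all_algebra.
From mathcomp Require Import all_classical all_reals all_analysis.
From mathcomp Require Import complex.
From mathcomp Require Import ring lra.

Set Implicit Arguments.
Unset Strict Implicit.
Unset Printing Implicit Defensive.

Import Order.TTheory GRing.Theory Num.Theory.
Import numFieldNormedType.Exports.

Local Open Scope classical_set_scope.
Local Open Scope ring_scope.

(** Let [G = L C = P C^T Q C] and let [e_i] be the observation error of agent
    [i]. The closed loop reads
      [x_i' = (A - B K) x_i + B K e_i],
      [e_i' = A e_i - G \sum_j (laplacian i j) e_j],
    the errors being autonomous.

    Positivity. Since [B K] and [G] are nonnegative and [A - B K] and
    [A - lmax G] are Metzler, the whole system is a linear Metzler system. Such a
    system preserves nonnegative states ([positive_system]), because the sum of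
    the squares of the negative parts of the coordinates satisfies Gronwall's
    inequality.

    Consensus of the errors. The differences with the error of the first agent
    solve [F' = A F - G F N], where [N] is the transpose of the Laplacian acting
    modulo constants, whose eigenvalues are those of the Laplacian but one 0
    ([char_poly_deflate]); by Gershgorin's theorem the real part of all of them
    is at least [re_lambda2 >= 0] ([deflated_laplacian_spectrum]). For a complex
    vector [q] and an eigenvalue [z] of [N], the combination [F q] solves
    [(F q)' = (A - z G) (F q) - G (F (N - z) q)]. The matrix inequality of the
    hypotheses, after completing a square, gives the Lyapunov inequality
    [(A - z G) P + P (A - z G)^* < 0] as soon as [Re z >= re_lambda2]
    ([lmi_admissible]); hence [F q] tends to 0 if [F (N - z) q] does
    ([decays_shift]). The product of all factors [N - z] is 0 by
    Cayley-Hamilton, so that every [F q] tends to 0 ([vanishes_of_spectrum]).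

    Consensus of the states. A difference of two states obeys [A - B K], for
    which [D^-1] is a Lyapunov function, with an input [B K (e_j - e_i)] that
    tends to 0.

    All convergences rest on [lyapunov_vanishes]: a linear system with a quadratic
    Lyapunov function and a vanishing input tends to 0. *)

(** * Differential inequalities on the half-line *)

Section Evolution.
Variable R : realType.
Implicit Types (f g df dg : R -> R) (c t : R).

(** The regularity of a trajectory on the half-line: nothing is asked of the
    derivative at time 0, where continuity is enough for the mean value
    theorem. *)
Definition evolves f df : Prop :=
  {within [set t : R | 0 <= t], continuous f} /\
  forall t : R, 0 < t -> is_derive t (1 : R) f (df t).

Lemma evolves_ext f g df dg :
  f =1 g -> (forall t, 0 < t -> df t = dg t) -> evolves f df -> evolves g dg.
Proof.
move=> /funext <- dfg [cf hf]; split=> // t t0.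
by rewrite -dfg//; exact: hf.
Qed.

Lemma evolves_cst c : evolves (fun=> c) (fun=> 0).
Proof.
split; last by move=> t _; exact: is_derive_cst.
by apply: continuous_subspaceT => x; exact: cvg_cst.
Qed.

Lemma evolvesD f g df dg : evolves f df -> evolves g dg ->
  evolves (fun t => f t + g t) (fun t => df t + dg t).
Proof.
move=> [cf hf] [cg hg]; split; last first.
  by move=> t t0; apply: is_deriveD; [exact: hf | exact: hg].
by move=> x; apply: cvgD; [exact: cf | exact: cg].
Qed.

Lemma evolvesM f g df dg : evolves f df -> evolves g dg ->
  evolves (fun t => f t * g t) (fun t => df t * g t + f t * dg t).
Proof.
move=> [cf hf] [cg hg]; split; last first.
  move=> t t0; apply: (is_derive_eq (is_deriveM (hf t t0) (hg t t0))).
  by rewrite /GRing.scale/= addrC; congr (_ + _); rewrite mulrC.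
by move=> x; apply: cvgM; [exact: cf | exact: cg].
Qed.

Lemma evolves_sum (I : Type) (r : seq I) (F dF : I -> R -> R) :
  (forall i, evolves (F i) (dF i)) ->
  evolves (fun t => \sum_(i <- r) F i t) (fun t => \sum_(i <- r) dF i t).
Proof.
move=> h; elim: r => [|i r ih].
  by apply: evolves_ext (evolves_cst 0) => [t|t _]; rewrite big_nil.
by apply: evolves_ext (evolvesD (h i) ih) => [t|t _]; rewrite big_cons.
Qed.

Lemma evolves_expR c : evolves (fun t => expR (c * t)) (fun t => c * expR (c * t)).
Proof.
have d t : is_derive t (1 : R) (fun t => expR (c * t)) (c * expR (c * t)).
  have h : is_derive t (1 : R) (fun t => c * t) c.
    apply: (is_derive_eq (is_deriveZ c (is_derive_id t (1 : R)))).
    by rewrite /GRing.scale/= mulr1.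
  apply: (is_derive_eq (is_derive1_comp (is_derive_expR _) h)).
  by rewrite /GRing.scale/= mulrC.
split; last by move=> t _; exact: d.
apply: continuous_subspaceT => x; apply/differentiable_continuous/derivable1_diffP.
by have [] := d x.
Qed.

Lemma evolves_le f df T t : evolves f df ->
  (forall s, T < s -> df s <= 0) -> 0 <= T -> T <= t -> f t <= f T.
Proof.
move=> [cf hf] hd T0; rewrite le_eqVlt => /predU1P[->//|Tt].
have [||s] := @MVT R f df T t Tt.
- move=> s; rewrite in_itv/= => /andP[Ts _]; apply: hf; exact: le_lt_trans Ts.
- apply: continuous_subspaceW cf => s /=; rewrite in_itv/= => /andP[+ _].
  exact: le_trans.
rewrite in_itv/= => /andP[Ts _] e; rewrite -subr_le0 e.
by rewrite mulr_le0_ge0 ?hd// subr_ge0 ltW.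
Qed.

(** Multiplying by the integrating factor [exp (- c t)] turns the inequality
    into monotonicity. *)
Lemma gronwall f df c T t : evolves f df ->
  (forall s, T < s -> df s <= c * f s) -> 0 <= T -> T <= t ->
  f t <= f T * expR (c * (t - T)).
Proof.
move=> ev hd T0 Tt.
have h H := evolves_le (evolvesM ev (evolves_expR (- c))) H T0 Tt.
have {}h : f t * expR (- c * t) <= f T * expR (- c * T).
  apply: h => s Ts.
  rewrite [X in _ + X](_ : _ = - (c * f s) * expR (- c * s)); last by ring.
  by rewrite -mulrDl mulr_le0_ge0 ?expR_ge0// subr_le0 hd.
rewrite -(ler_pM2r (expR_gt0 (- c * t))) -mulrA -expRD.
by rewrite (_ : c * (t - T) + - c * t = - c * T); last by ring.
Qed.

(** Once the input [g] is below [c * (e / 2)], the excess [f - e / 2] satisfies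
    a homogeneous inequality and decays exponentially, so that [f] ends up below
    [e]. *)
Lemma evolves_vanish f df g c : evolves f df -> 0 < c -> (forall t, 0 <= f t) ->
  (forall t, 0 < t -> df t <= - c * f t + g t) ->
  g t @[t --> +oo] --> 0 -> f t @[t --> +oo] --> 0.
Proof.
move=> ev c0 f0 hd g0; apply/cvgr0Pnorm_le => e e0.
have [T [_ hT]] : \forall t \near +oo, `|g t| <= c * (e / 2).
  by move/cvgr0Pnorm_le : g0; apply; rewrite mulr_gt0// divr_gt0.
pose T0 := Num.max T 0.
have T00 : 0 <= T0 by rewrite le_max lexx orbT.
have TT0 : T <= T0 by rewrite le_max lexx.
have ev' : evolves (fun t => f t - e / 2) df.
  apply: evolves_ext (evolvesD ev (evolves_cst (- (e / 2)))) => // t _.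
  by rewrite addr0.
have key t : T0 <= t -> f t - e / 2 <= (f T0 - e / 2) * expR (- c * (t - T0)).
  apply: (gronwall ev') => // s T0s.
  have := hd s (le_lt_trans T00 T0s).
  have := hT s (le_lt_trans TT0 T0s).
  by rewrite ler_norml => /andP[_]; lra.
(* The denominator bounds the initial excess at time [T0]. *)
have [T1 [_ hT1]] : \forall t \near +oo, expR (- t) <= e / 2 / (`|f T0 - e / 2| + 1).
  have d0 : 0 < e / 2 / (`|f T0 - e / 2| + 1) by rewrite !divr_gt0// ltr_wpDl.
  have /cvgr0Pnorm_le/(_ _ d0) := @cvgr_expR R.
  by apply: filterS => t; rewrite ger0_norm ?expR_ge0.
exists (Num.max T0 (T0 + T1 / c)); split; first exact: num_real.
move=> t; rewrite gt_max => /andP[T0t T1t].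
rewrite ger0_norm//.
have := key t (ltW T0t).
have : T1 < c * (t - T0) by rewrite mulrC -ltr_pdivrMr// ltrBrDl.
move/hT1; rewrite -mulNr; set E := expR _; rewrite ler_pdivlMr ?ltr_wpDl//.
have E0 : 0 <= E by exact: expR_ge0.
have := ler_wpM2r E0 (ler_norm (f T0 - e / 2)).
set N := `|_|; lra.
Qed.

End Evolution.

(** * Positivity of Metzler systems *)

Lemma le_mul_of_sqr (R : realDomainType) (a b v : R) :
  a ^+ 2 <= v -> b ^+ 2 <= v -> a * b <= v.
Proof. by have := sqr_ge0 (a - b); lra. Qed.

Section Positivity.
Variable R : realType.

(** The square makes the negative part differentiable also at its kink. *)
Lemma is_derive_sqr_min0 (s : R) :
  is_derive s (1 : R) (fun s => Num.min s 0 ^+ 2) (2 * Num.min s 0).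
Proof.
have bound (h : R) :
    `|Num.min (s + h) 0 ^+ 2 - Num.min s 0 ^+ 2 - 2 * Num.min s 0 * h|
      <= h ^+ 2.
  by rewrite ler_norml; case: (lerP s 0) => s0; case: (lerP (s + h) 0) => sh0;
    apply/andP; split; nra.
have lim : h^-1 *: (Num.min (h *: (1 : R) + s) 0 ^+ 2 - Num.min s 0 ^+ 2)
    @[h --> 0^'] --> 2 * Num.min s 0.
  apply/cvgrPdist_le => e e0; near=> h.
  have h0 : h != 0 by near: h; exact: nbhs_dnbhs_neq.
  have he : `|h| <= e.
    near: h; apply: nbhs_dnbhs.
    by apply: (@cvgr0_norm_le _ _ _ (nbhs (0 : R)) _ id).
  apply: le_trans he; have hgt0 : 0 < `|h| by rewrite normr_gt0.
  rewrite -(ler_pM2l hgt0) -normrM /GRing.scale/= mulr1 mulrBr mulVKf//.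
  rewrite -expr2 real_normK ?num_real//.
  by rewrite distrC [h + s]addrC [h * _]mulrC; exact: bound.
by apply: DeriveDef; [apply/cvg_ex; exists (2 * Num.min s 0) | exact: cvg_lim lim].
Unshelve. all: by end_near.
Qed.

Lemma evolves_sqr_min0 (f df : R -> R) : evolves f df ->
  evolves (fun t => Num.min (f t) 0 ^+ 2) (fun t => 2 * Num.min (f t) 0 * df t).
Proof.
move=> [cf hf]; split; last first.
  move=> t t0.
  apply: (is_derive_eq (is_derive1_comp (is_derive_sqr_min0 (f t)) (hf t t0))).
  by rewrite /GRing.scale/= mulrC.
move=> x.
apply: (@cvg_comp _ _ _ f (fun s => Num.min s 0 ^+ 2) _ _ _ (cf x)).
have cphi : {for f x, continuous (fun s : R => Num.min s 0 ^+ 2)}.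
  apply/differentiable_continuous/derivable1_diffP.
  by have [] := is_derive_sqr_min0 (f x).
exact: cphi.
Qed.

(** The energy [V] of the negative parts vanishes at time 0. A nonnegative
    off-diagonal coefficient can only push a negative coordinate upwards, except
    through the negative parts of the others; hence [V' <= c V], and [V] stays
    null by Gronwall's inequality. *)
Lemma positive_system (J : finType) (M : J -> J -> R) (y : J -> R -> R) :
  (forall j k, j != k -> 0 <= M j k) ->
  (forall j, evolves (y j) (fun t => \sum_k M j k * y k t)) ->
  (forall j, 0 <= y j 0) ->
  forall t, 0 <= t -> forall j, 0 <= y j t.
Proof.
move=> Mge0 ev y0.
pose m j (t : R) : R := Num.min (y j t) 0.
pose V (t : R) : R := \sum_j m j t ^+ 2.
have evV := evolves_sum (index_enum J) (fun j => evolves_sqr_min0 (ev j)).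
have mV j t : m j t ^+ 2 <= V t.
  by rewrite /V (bigD1 j)//= lerDl sumr_ge0// => k _; exact: sqr_ge0.
have V0 : V 0 = 0.
  by rewrite /V big1// => j _; rewrite /m min_r// expr0n.
pose c : R := \sum_j \sum_k 2 * `|M j k|.
have dV t : \sum_j 2 * m j t * (\sum_k M j k * y k t) <= c * V t.
  rewrite /c mulr_suml; apply: ler_sum => j _.
  rewrite mulr_sumr mulr_suml; apply: ler_sum => k _.
  have mm : `|m j t| * `|m k t| <= V t.
    have := mV k t; have := mV j t.
    rewrite -(real_normK (num_real (m j t))).
    rewrite -(real_normK (num_real (m k t))).
    exact: le_mul_of_sqr.
  have mjk : m j t * (M j k * y k t) <= M j k * (m j t * m k t).
    have [jk|/Mge0 Mjk] := eqVneq j k.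
      by rewrite -jk /m; case: (lerP (y j t) 0) => _;
        rewrite ?(mul0r, mulr0) ?lexx // mulrCA lexx.
    rewrite mulrCA ler_wpM2l//.
    by rewrite /m; case: (lerP (y j t) 0) => ?; case: (lerP (y k t) 0) => ?;
      rewrite ?(mul0r, mulr0) ?lexx // ?mulr_le0_ge0 // ?ler_wnM2l // ltW.
  apply: (@le_trans _ _ (2 * (M j k * (m j t * m k t)))).
    by rewrite -mulrA ler_pM2l.
  rewrite -mulrA ler_pM2l//; apply: le_trans (ler_norm _) _.
  by rewrite !normrM ler_wpM2l.
move=> t t0 j.
have := gronwall evV (fun s _ => dV s) (lexx 0) t0.
rewrite -/(V t) -/(V 0) V0 mul0r => Vt.
have : m j t ^+ 2 = 0 by apply/le_anti; rewrite sqr_ge0 (le_trans (mV j t) Vt).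
by move=> /eqP; rewrite sqrf_eq0 /m; case: (lerP (y j t) 0) => [_ /eqP ->//|/ltW//].
Qed.

End Positivity.

(** * Positive definite forms *)

Definition bform (R : realType) n (N : 'M[R]_n) (x y : 'cV[R]_n) : R :=
  (x^T *m N *m y) 0 0.

Lemma bform_congr (R : realType) n k (M : 'M[R]_(n, k)) (N : 'M[R]_n)
    (x y : 'cV[R]_k) :
  bform N (M *m x) (M *m y) = bform (M^T *m N *m M) x y.
Proof. by rewrite /bform trmx_mul !mulmxA. Qed.

Section QuadraticForms.
Variables (R : realType) (n : nat).
Implicit Types (N H : 'M[R]_n) (x y : 'cV[R]_n) (c : R).

Lemma bformE N x y : bform N x y = \sum_i \sum_j x i 0 * N i j * y j 0.
Proof.
rewrite /bform mxE exchange_big; apply: eq_bigr => j _; rewrite mxE mulr_suml.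
by apply: eq_bigr => i _; rewrite mxE.
Qed.

Lemma bform_sym N x y : N^T = N -> bform N x y = bform N y x.
Proof.
move=> NT; rewrite /bform -[in RHS]NT -[x in RHS]trmxK.
by rewrite -!trmx_mul [RHS]mxE mulmxA.
Qed.

Lemma bformDl N x1 x2 y : bform N (x1 + x2) y = bform N x1 y + bform N x2 y.
Proof. by rewrite /bform linearD !mulmxDl mxE. Qed.

Lemma bformDr N x y1 y2 : bform N x (y1 + y2) = bform N x y1 + bform N x y2.
Proof. by rewrite /bform mulmxDr mxE. Qed.

Lemma bformZl N c x y : bform N (c *: x) y = c * bform N x y.
Proof. by rewrite /bform linearZ -!scalemxAl mxE. Qed.

Lemma bformZr N c x y : bform N x (c *: y) = c * bform N x y.
Proof. by rewrite /bform -scalemxAr mxE. Qed.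

Lemma posdef_ge0 N x : posdef N -> 0 <= bform N x x.
Proof.
move=> [_ N0]; have [->|/N0/ltW//] := eqVneq x 0.
by rewrite /bform mulmx0 mxE.
Qed.

Lemma posdef_unit N : posdef N -> N \in unitmx.
Proof.
move=> [NT N0]; rewrite unitmxE unitfE; apply/negP => /det0P[v v0 vN].
have := N0 v^T; rewrite trmxK vN mul0mx mxE ltxx => /(_ _)/negP; apply => //.
by apply: contra_neq v0 => /(congr1 trmx); rewrite trmxK trmx0.
Qed.

Lemma posdef_inv N : posdef N -> posdef (invmx N).
Proof.
move=> Np; have Nu := posdef_unit Np; have [NT N0] := Np.
split=> [|v v0]; first by rewrite trmx_inv NT.
have -> : v^T *m invmx N *m v = (invmx N *m v)^T *m N *m (invmx N *m v).
  by rewrite trmx_mul trmx_inv NT -!mulmxA mulKVmx.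
apply: N0; apply: contra_neq v0 => /(congr1 (mulmx N)).
by rewrite mulKVmx// mulmx0.
Qed.

(** Nonnegativity of the form at [c x - b y], where [b] is the product of [x]
    and [y] and [c] the value at [y]. *)
Lemma cauchy_schwarz N x y : posdef N ->
  bform N x y ^+ 2 <= bform N x x * bform N y y.
Proof.
move=> Np; have [NT N0] := Np; have [->|/N0] := eqVneq y 0.
  by rewrite /bform !mulmx0 mxE mulr0 expr0n.
rewrite -[X in 0 < X]/(bform N y y) => y0.
have := posdef_ge0 (bform N y y *: x + (- bform N x y) *: y) Np.
rewrite !(bformDl, bformDr, bformZl, bformZr) (bform_sym y x NT).
set a := bform N x x; set b := bform N x y; set d := bform N y y => h.
rewrite -subr_ge0 -(pmulr_rge0 _ y0); apply: le_trans h _.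
by rewrite le_eqVlt; apply/orP; left; apply/eqP; rewrite /d; ring.
Qed.

(** Cauchy-Schwarz against the [i]-th column of [invmx N], which represents the
    [i]-th coordinate in the scalar product of [N]. This gives the coercivity of
    [N] with an explicit constant, without compactness of the sphere. *)
Lemma posdef_coord N y i : posdef N ->
  y i 0 ^+ 2 <= invmx N i i * bform N y y.
Proof.
move=> Np; have Nu := posdef_unit Np; have [NT _] := Np.
have colN z : bform N (col i (invmx N)) z = z i 0.
  by rewrite /bform tr_col trmx_inv NT -!row_mul mulVmx// mul1mx mxE.
by have := cauchy_schwarz (col i (invmx N)) y Np; rewrite !colN mxE.
Qed.

Lemma posdef_dominates N H : posdef N ->
  exists2 k : R, 0 < k & forall y, bform H y y <= k * bform N y y.
Proof.
move=> Np; pose T := \sum_i invmx N i i.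
have diag0 i : 0 <= invmx N i i.
  have := posdef_ge0 (delta_mx i 0) (posdef_inv Np).
  by rewrite /bform trmx_delta -rowE -colE !mxE.
(* The added 1 only makes the constant positive. *)
exists (\sum_i \sum_j `|H i j| * T + 1) => [|y].
  rewrite ltr_wpDl// sumr_ge0// => i _; rewrite sumr_ge0// => j _.
  by rewrite mulr_ge0// sumr_ge0.
have q0 := posdef_ge0 y Np.
have coord i : `|y i 0| ^+ 2 <= T * bform N y y.
  rewrite real_normK ?num_real//; apply: le_trans (posdef_coord y i Np) _.
  by rewrite ler_wpM2r// /T (bigD1 i)//= lerDl sumr_ge0.
rewrite mulrDl mul1r.
apply: le_trans (_ : _ <= \sum_i \sum_j `|H i j| * T * bform N y y) _.
  rewrite bformE; apply: ler_sum => i _; apply: ler_sum => j _.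
  apply: le_trans (ler_norm _) _.
  rewrite !normrM [leLHS]mulrAC [leLHS]mulrC -[leRHS]mulrA ler_wpM2l//.
  exact: le_mul_of_sqr.
rewrite -[leLHS]addr0 lerD// mulr_suml; apply: ler_sum => i _.
by rewrite mulr_suml.
Qed.

End QuadraticForms.

(** * Stability under a vanishing input *)

Section MatrixEvolution.
Variable R : realType.

Definition evolves_mx m n (y dy : R -> 'M[R]_(m, n)) : Prop :=
  forall i j, evolves (fun t => y t i j) (fun t => dy t i j).

Definition vanishes m n (y : R -> 'M[R]_(m, n)) : Prop :=
  forall i j, y t i j @[t --> +oo] --> 0.

Lemma evolves_mx_ext m n (y dy z dz : R -> 'M[R]_(m, n)) :
  y =1 z -> (forall t, 0 < t -> dy t = dz t) -> evolves_mx y dy -> evolves_mx z dz.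
Proof.
move=> /funext <- dyz ev i j.
by apply: evolves_ext (ev i j) => // t t0; rewrite dyz.
Qed.

Lemma evolves_mx_cst m n (M : 'M[R]_(m, n)) : evolves_mx (fun=> M) (fun=> 0).
Proof.
move=> i j; apply: evolves_ext (evolves_cst (M i j)) => // t _.
by rewrite mxE.
Qed.

Lemma evolves_mxD m n (y z dy dz : R -> 'M[R]_(m, n)) :
  evolves_mx y dy -> evolves_mx z dz ->
  evolves_mx (fun t => y t + z t) (fun t => dy t + dz t).
Proof.
by move=> hy hz i j; apply: evolves_ext (evolvesD (hy i j) (hz i j)) => [t|t _];
  rewrite mxE.
Qed.

Lemma evolves_mulmx m n p (y dy : R -> 'M[R]_(m, n)) (z dz : R -> 'M[R]_(n, p)) :
  evolves_mx y dy -> evolves_mx z dz ->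
  evolves_mx (fun t => y t *m z t) (fun t => dy t *m z t + y t *m dz t).
Proof.
move=> hy hz i j.
pose ev := evolves_sum (index_enum 'I_n) (fun k => evolvesM (hy i k) (hz k j)).
apply: evolves_ext ev => [t|t _].
  by rewrite mxE.
by rewrite !mxE big_split.
Qed.

Lemma evolves_mulmxl m n p (M : 'M[R]_(m, n)) (y dy : R -> 'M[R]_(n, p)) :
  evolves_mx y dy -> evolves_mx (fun t => M *m y t) (fun t => M *m dy t).
Proof.
move=> hy; apply: evolves_mx_ext (evolves_mulmx (evolves_mx_cst M) hy) => // t _.
by rewrite mul0mx add0r.
Qed.

Lemma evolves_mulmxr m n p (M : 'M[R]_(n, p)) (y dy : R -> 'M[R]_(m, n)) :
  evolves_mx y dy -> evolves_mx (fun t => y t *m M) (fun t => dy t *m M).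
Proof.
move=> hy; apply: evolves_mx_ext (evolves_mulmx hy (evolves_mx_cst M)) => // t _.
by rewrite mulmx0 addr0.
Qed.

Lemma vanishes_ext m n (y z : R -> 'M[R]_(m, n)) :
  y =1 z -> vanishes y -> vanishes z.
Proof. by move=> /funext <-. Qed.

Lemma cvg0D (f g : R -> R) : f t @[t --> +oo] --> 0 -> g t @[t --> +oo] --> 0 ->
  f t + g t @[t --> +oo] --> 0.
Proof.
by move=> f0 g0; rewrite -[0](addr0 0); exact: cvgD.
Qed.

Lemma cvg0M (f g : R -> R) : f t @[t --> +oo] --> 0 -> g t @[t --> +oo] --> 0 ->
  f t * g t @[t --> +oo] --> 0.
Proof.
by move=> f0 g0; rewrite -[0](mulr0 0); exact: cvgM.
Qed.

Lemma vanishesD m n (y z : R -> 'M[R]_(m, n)) :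
  vanishes y -> vanishes z -> vanishes (fun t => y t + z t).
Proof.
move=> hy hz i j; under eq_fun do rewrite mxE.
exact: cvg0D.
Qed.

Lemma cvg0_sum (I : Type) (r : seq I) (F : I -> R -> R) :
  (forall i, F i t @[t --> +oo] --> 0) ->
  (\sum_(i <- r) F i t) @[t --> +oo] --> (0 : R).
Proof.
move=> h; elim: r => [|i r ih].
  under eq_fun do rewrite big_nil.
  exact: cvg_cst.
under eq_fun do rewrite big_cons.
exact: cvg0D.
Qed.

Lemma cvg0_mull (c : R) (f : R -> R) :
  f t @[t --> +oo] --> 0 -> c * f t @[t --> +oo] --> 0.
Proof.
move=> f0; rewrite -[0](mulr0 c).
by apply: cvgM => //; exact: cvg_cst.
Qed.

Lemma vanishes_mulmx m n p (y : R -> 'M[R]_(m, n)) (z : R -> 'M[R]_(n, p)) :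
  vanishes y -> vanishes z -> vanishes (fun t => y t *m z t).
Proof.
move=> hy hz i j; under eq_fun do rewrite mxE.
by apply: cvg0_sum => k; exact: cvg0M.
Qed.

Lemma vanishes_mulmxl m n p (M : 'M[R]_(m, n)) (y : R -> 'M[R]_(n, p)) :
  vanishes y -> vanishes (fun t => M *m y t).
Proof.
move=> hy i j; under eq_fun do rewrite mxE.
by apply: cvg0_sum => k; apply: cvg0_mull; exact: hy.
Qed.

Lemma vanishes_tr m n (y : R -> 'M[R]_(m, n)) :
  vanishes y -> vanishes (fun t => (y t)^T).
Proof.
move=> hy i j; under eq_fun do rewrite mxE.
exact: hy.
Qed.

Lemma vanishes_mulmxr m n p (M : 'M[R]_(n, p)) (y : R -> 'M[R]_(m, n)) :
  vanishes y -> vanishes (fun t => y t *m M).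
Proof.
move=> /vanishes_tr/(vanishes_mulmxl M^T)/vanishes_tr.
by apply: vanishes_ext => t; rewrite trmx_mul !trmxK.
Qed.

(** Lyapunov's method: [P^-1] defines the energy [V] of [y], and by congruence
    with [P^-1] the hypothesis says that [N], the rate of dissipation, is
    positive definite. [N] dominates a multiple [k^-1] of [V]; half of it absorbs
    the cross term with [w] by Young's inequality, so that
    [V' <= - V / (2 k) + 2 k |w|^2], the norm being that of [P^-1]. *)
Lemma lyapunov_vanishes n (P M : 'M[R]_n) (y w : R -> 'cV[R]_n) :
  posdef P -> negdef (M *m P + P *m M^T) ->
  evolves_mx y (fun t => M *m y t + w t) -> vanishes w -> vanishes y.
Proof.
move=> Pp [NT Nn] ev hw.
have Hp := posdef_inv Pp; have Pu := posdef_unit Pp; have [PT _] := Pp.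
set H := invmx P in Hp; have [HT _] := Hp.
pose N := - (H *m M + M^T *m H).
have HPH : H *m (M *m P + P *m M^T) *m H = H *m M + M^T *m H.
  rewrite mulmxDr mulmxDl /H; congr (_ + _); rewrite -!mulmxA.
    by rewrite mulmxV// mulmx1.
  by rewrite mulKmx.
have NE v : bform N v v = - bform (M *m P + P *m M^T) (H *m v) (H *m v).
  by rewrite bform_congr HT HPH /bform mulmxN mulNmx [LHS]mxE.
have Np : posdef N.
  split=> [|v v0].
    by rewrite /N linearN linearD/= !trmx_mul trmxK HT addrC.
  rewrite -[X in 0 < X]/(bform N v v) NE oppr_gt0; apply: Nn.
  by apply: contra_neq v0 => /(congr1 (mulmx P)); rewrite mulKVmx// mulmx0.
have [k k0 hk] := posdef_dominates H Np.
pose V (t : R) : R := bform H (y t) (y t).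
have evyT : evolves_mx (fun t => (y t)^T) (fun t => (M *m y t + w t)^T).
  by move=> i j; apply: evolves_ext (ev j i) => [t|t _]; rewrite !mxE.
have evV := evolves_mulmx (evolves_mulmxr H evyT) ev.
have dVE t :
    ((M *m y t + w t)^T *m H *m y t + (y t)^T *m H *m (M *m y t + w t)) 0 0 =
    - bform N (y t) (y t) + 2 * bform H (y t) (w t).
  rewrite mxE -!/(bform H _ _) bformDl bformDr [bform H (w t) _]bform_sym//.
  have -> : bform N (y t) (y t) =
      - (bform H (y t) (M *m y t) + bform H (M *m y t) (y t)).
    rewrite /N /bform mulmxN mulNmx [LHS]mxE mulmxDr mulmxDl [in LHS]mxE.
    by rewrite trmx_mul !mulmxA.
  by ring.
have young t :
    2 * bform H (y t) (w t) <= (2 * k)^-1 * V t + 2 * k * bform H (w t) (w t).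
  have := posdef_ge0 ((2 * k)^-1 *: y t + (-1) *: w t) Hp.
  rewrite !(bformDl, bformDr, bformZl, bformZr).
  rewrite [bform H (w t) (y t)]bform_sym// -/(V t).
  move: (bform H (y t) (w t)) (bform H (w t) (w t)) (V t) => b d v h.
  have : 0 <= 2 * k * ((2 * k)^-1 * ((2 * k)^-1 * v + (-1) * b)
                       + (-1) * ((2 * k)^-1 * b + (-1) * d)).
    rewrite mulr_ge0// ?mulr_ge0 ?(ltW k0)//.
    by apply: le_trans h _; rewrite le_eqVlt; apply/orP; left; apply/eqP; ring.
  rewrite (_ : 2 * k * _ = (2 * k)^-1 * v + 2 * k * d - 2 * b) ?subr_ge0//.
  by field; rewrite gt_eqF.
have V0 t : 0 <= V t by exact: posdef_ge0.
have Vto0 : V t @[t --> +oo] --> 0.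
  apply: (evolves_vanish (f := V) (evV 0 0) (c := (2 * k)^-1)
    (g := fun t => 2 * k * bform H (w t) (w t))) => //.
  - by rewrite invr_gt0 mulr_gt0.
  - move=> t t0; rewrite dVE /=; have := young t; have := hk (y t); rewrite -!/(V t).
    move: (bform H (y t) (w t)) (bform H (w t) (w t)) (V t) (bform N _ _).
    move=> b d v q.
    rewrite -ler_pdivrMl// => h1.
    set x : R := (2 * k)^-1 * v => h2; rewrite mulNr -/x.
    have hx : k^-1 * v = 2 * x by rewrite /x; field; rewrite gt_eqF.
    move: h1 h2; rewrite {}hx; move: x (2 * k * d : R) => x z; lra.
  - apply: cvg0_mull.
    exact: (vanishes_mulmx (vanishes_mulmxr H (vanishes_tr hw)) hw 0 0).
move=> i j; rewrite ord1; apply/cvgr0Pnorm_le => e e0.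
have e2 : 0 < e ^+ 2 by rewrite exprn_gt0.
have /cvgr0Pnorm_le/(_ _ e2) :
    invmx H i i * V t @[t --> +oo] --> 0.
  exact: cvg0_mull.
apply: filterS => t hV; rewrite -(ler_pXn2r (n := 2))// ?nnegrE ?(ltW e0)//.
rewrite real_normK ?num_real//; apply: le_trans hV.
exact: le_trans (posdef_coord (y t) i Hp) (ler_norm _).
Qed.

End MatrixEvolution.

(** * Decay of the modes *)

Section Modes.
Variables (R : realType) (r : nat).

Lemma bform_block_diag (N : 'M[R]_r) (v : 'cV[R]_(r + r)) :
  bform (block_mx N 0 0 N) v v =
  bform N (usubmx v) (usubmx v) + bform N (dsubmx v) (dsubmx v).
Proof.
rewrite -{1 2}[v]vsubmxK /bform tr_col_mx mul_row_block !mulmx0 addr0 add0r.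
by rewrite mul_row_col mxE.
Qed.

Lemma posdef_block_diag (N : 'M[R]_r) : posdef N -> posdef (block_mx N 0 0 N).
Proof.
move=> Np; have [NT N0] := Np; split; first by rewrite tr_block_mx NT !trmx0.
move=> v v0; rewrite -[X in 0 < X]/(bform _ v v) bform_block_diag.
have [u0|/N0 u0] := eqVneq (usubmx v) 0; last exact/ltr_wpDr/u0/posdef_ge0.
apply: ltr_wpDl; [exact: posdef_ge0 | apply: N0].
by apply: contra_neq v0 => d0; rewrite -[v]vsubmxK u0 d0 col_mx0.
Qed.

Lemma negdefE n (N : 'M[R]_n) : negdef N <-> posdef (- N).
Proof.
by split=> -[NT N0]; split=> [|v /N0]; rewrite ?mulmxN ?mulNmx ?mxE ?oppr_gt0//;
  [rewrite linearN/= NT | apply: oppr_inj; rewrite -linearN].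
Qed.

(** The real and imaginary parts [u] and [v] of a solution of
    [z' = (A - (a + i b) G) z - G (s + i s')]. The symmetry of [G P] cancels the
    contribution of [b] to the Lyapunov inequality of the real block system, with
    [P] repeated on the diagonal: only the real part of the eigenvalue
    matters. *)
Lemma mode_vanishes (A G P : 'M[R]_r) (a b : R) (u v s s' : R -> 'cV[R]_r) :
  posdef P -> (G *m P)^T = G *m P ->
  negdef ((A - a *: G) *m P + P *m (A - a *: G)^T) ->
  evolves_mx u (fun t => (A - a *: G) *m u t + b *: G *m v t - G *m s t) ->
  evolves_mx v (fun t => (A - a *: G) *m v t - b *: G *m u t - G *m s' t) ->
  vanishes s -> vanishes s' -> vanishes u /\ vanishes v.
Proof.
move=> Pp GP /negdefE Nn evu evv hs hs'; set A' := A - a *: G in Nn evu evv *.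
have [PT _] := Pp.
pose M := block_mx A' (b *: G) (- (b *: G)) A'.
suff h : vanishes (fun t => col_mx (u t) (v t)).
  by split=> i j; [have := h (lshift r i) j | have := h (rshift r i) j];
    under eq_fun do rewrite ?col_mxEu ?col_mxEd.
apply: (@lyapunov_vanishes _ _ (block_mx P 0 0 P) M _
  (fun t => col_mx (- (G *m s t)) (- (G *m s' t)))).
- exact: posdef_block_diag.
- apply/negdefE; set N := - (A' *m P + _) in Nn.
  suff -> : - (M *m block_mx P 0 0 P + block_mx P 0 0 P *m M^T) =
      block_mx N 0 0 N.
    exact: posdef_block_diag.
  rewrite /M tr_block_mx !mulmx_block !mulmx0 !mul0mx !addr0 !add0r.
  rewrite add_block_mx opp_block_mx.
  have GPE : P *m G^T = G *m P by rewrite -[P in LHS]PT -trmx_mul GP.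
  have trG c : (c *: G)^T = c *: G^T by rewrite linearZ.
  have trN (Y : 'M[R]_r) : (- Y)^T = - Y^T by rewrite linearN.
  rewrite !(trN, trG, mulmxN, mulNmx) -!scalemxAl -!scalemxAr GPE.
  by rewrite subrr addNr oppr0.
- move=> i j; case: (split_ordP i) => k ->.
    by apply: evolves_ext (evu k j) => [t|t _];
      rewrite ?mul_block_col ?add_col_mx col_mxEu.
  apply: evolves_ext (evv k j) => [t|t _];
    rewrite ?mul_block_col ?add_col_mx col_mxEd//.
  by rewrite mulNmx (addrC (- _)).
- move=> i j; case: (split_ordP i) => k ->.
    under eq_fun do rewrite col_mxEu -mulNmx.
    exact: vanishes_mulmxl.
  under eq_fun do rewrite col_mxEd -mulNmx.
  exact: vanishes_mulmxl.
Qed.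

Section Spectral.
Variables (n : nat) (A G P : 'M[R]_r) (N : 'M[R]_n.+1).
Variable F : R -> 'M[R]_(r, n.+1).
Hypotheses (Pp : posdef P) (GP : (G *m P)^T = G *m P).
Hypothesis evF : evolves_mx F (fun t => A *m F t - G *m F t *m N).

(** [P^-1] is a Lyapunov function for [A - a G]. *)
Definition admissible (a : R) := negdef ((A - a *: G) *m P + P *m (A - a *: G)^T).

(** The combination of the columns of [F] with the complex coefficients [q]
    tends to 0. *)
Definition decays (q : 'cV[R[i]]_n.+1) :=
  vanishes (fun t => F t *m map_mx (@complex.Re R) q) /\
  vanishes (fun t => F t *m map_mx (@complex.Im R) q).

Let ReD (x y : R[i]) : complex.Re (x + y) = complex.Re x + complex.Re y.
Proof. by case: x y => [? ?] [? ?]. Qed.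
Let ImD (x y : R[i]) : complex.Im (x + y) = complex.Im x + complex.Im y.
Proof. by case: x y => [? ?] [? ?]. Qed.

Lemma map_Re_complex_mx (q : 'cV[R[i]]_n.+1) :
  map_mx (@complex.Re R) (complex_mx N *m q) = N *m map_mx (@complex.Re R) q.
Proof.
apply/matrixP => i j; rewrite !mxE (big_morph _ ReD erefl).
by apply: eq_bigr => k _; rewrite !mxE; case: (q k j) => x y /=; rewrite mul0r subr0.
Qed.

Lemma map_Im_complex_mx (q : 'cV[R[i]]_n.+1) :
  map_mx (@complex.Im R) (complex_mx N *m q) = N *m map_mx (@complex.Im R) q.
Proof.
apply/matrixP => i j; rewrite !mxE (big_morph _ ImD erefl).
by apply: eq_bigr => k _; rewrite !mxE; case: (q k j) => x y /=; rewrite mul0r addr0.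
Qed.

(** The combination [z_q] with coefficients [q] obeys
    [z_q' = (A - z G) z_q - G z_s] with [s = (N - z) q]: a mode of [z] driven by a
    vanishing input. *)
Lemma decays_shift (z : R[i]) q : admissible (complex.Re z) ->
  decays (complex_mx N *m q - z *: q) -> decays q.
Proof.
move=> adm; set s := _ - _ => -[gs gs'].
set a := complex.Re z in adm; pose b := complex.Im z.
set u := map_mx (@complex.Re R) q; set v := map_mx (@complex.Im R) q.
have NuE : N *m u = map_mx (@complex.Re R) s + (a *: u - b *: v).
  rewrite -map_Re_complex_mx; apply/matrixP => i j; rewrite !mxE ReD -addrA.
  rewrite -[LHS]addr0; congr (_ + _).
  rewrite /a /b; case: z (q i j) {adm a b s gs gs'} => [z1 z2] [q1 q2] /=.
  by ring.
have NvE : N *m v = map_mx (@complex.Im R) s + (a *: v + b *: u).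
  rewrite -map_Im_complex_mx; apply/matrixP => i j; rewrite !mxE ImD -addrA.
  rewrite -[LHS]addr0; congr (_ + _).
  rewrite /a /b; case: z (q i j) {adm a b s gs gs' NuE} => [z1 z2] [q1 q2] /=.
  by ring.
apply: (mode_vanishes (b := b) Pp GP adm _ _ gs gs').
- apply: evolves_mx_ext (evolves_mulmxr u evF) => // t _.
  rewrite mulmxBl -!mulmxA NuE !(mulmxBl, mulmxDr, mulmxN).
  rewrite -!scalemxAl -!scalemxAr.
  by rewrite !opprD opprK [X in _ + X = _]addrC !addrA.
- apply: evolves_mx_ext (evolves_mulmxr v evF) => // t _.
  rewrite mulmxBl -!mulmxA NvE !(mulmxBl, mulmxDr, mulmxN).
  rewrite -!scalemxAl -!scalemxAr.
  by rewrite !opprD [X in _ + X = _]addrC !addrA.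
Qed.

(** Peeling off the factors one at a time plays the role of a triangularization
    of [N]. *)
Lemma decays_horner (zs : seq R[i]) q :
  (forall z, z \in zs -> admissible (complex.Re z)) ->
  decays (horner_mx (complex_mx N) (\prod_(z <- zs) ('X - z%:P)) *m q) ->
  decays q.
Proof.
elim: zs q => [|z zs ih] q adm; first by rewrite big_nil rmorph1 mul1mx.
rewrite big_cons rmorphM rmorphB /= horner_mx_X horner_mx_C -mulmxE -mulmxA.
rewrite mulmxBl mul_scalar_mx => /decays_shift gq.
apply: ih => [w wzs|]; first by apply: adm; rewrite inE wzs orbT.
by apply: gq; apply: adm; rewrite inE eqxx.
Qed.

(** By Cayley-Hamilton the product of all the [N - z] is 0, so every combination
    of the columns of [F] decays. *)
Lemma vanishes_of_spectrum (zs : seq R[i]) :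
  char_poly (complex_mx N) = \prod_(z <- zs) ('X - z%:P) ->
  (forall z, z \in zs -> admissible (complex.Re z)) ->
  vanishes F.
Proof.
move=> charN adm i j.
have : decays (map_mx (real_complex R) (delta_mx j 0)).
  apply: (decays_horner adm); rewrite -charN Cayley_Hamilton mul0mx.
  split; rewrite (_ : map_mx _ 0 = 0); try by apply/matrixP => i' j'; rewrite !mxE.
  - move=> i' j'; under eq_fun do rewrite mulmx0 mxE.
    exact: cvg_cst.
  - move=> i' j'; under eq_fun do rewrite mulmx0 mxE.
    exact: cvg_cst.
move=> [/(_ i 0) + _].
rewrite -map_mx_comp map_mx_id//.
by under eq_fun do rewrite -colE mxE.
Qed.

End Spectral.
End Modes.

(** * The spectrum of the Laplacian *)

Section Deflation.
Variables (K : comNzRingType) (n : nat).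

(** The matrix induced by [M] on the quotient by the constant vectors, in the
    basis of the differences with the first coordinate. *)
Definition deflate (M : 'M[K]_(1 + n)) : 'M[K]_n :=
  drsubmx M - const_mx 1 *m ursubmx M.

Definition differences : 'M[K]_(n, 1 + n) := row_mx (- const_mx 1) 1%:M.

(** When the rows of [M] sum to 0, [M] acts on vectors through their
    differences. *)
Lemma deflateE (M : 'M[K]_(1 + n)) :
  M *m const_mx 1 = 0 :> 'cV[K]_(1 + n) ->
  usubmx M = ursubmx M *m differences /\
  differences *m M = deflate M *m differences.
Proof.
pose one : 'cV[K]_n := const_mx 1; rewrite /differences -/one.
rewrite -{1}[M]submxK -[const_mx 1](@vsubmxK _ 1 n).
rewrite (_ : usubmx _ = 1%:M); last by apply/matrixP => i j; rewrite !ord1 !mxE.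
rewrite (_ : dsubmx _ = one); last by apply/matrixP => i j; rewrite !mxE.
rewrite mul_block_col !mulmx1 -[0](@col_mx0 K 1 n) => /eq_col_mx[/eqP ab /eqP cd].
have {}ab : ulsubmx M = - (ursubmx M *m one) by apply/eqP; rewrite -addr_eq0.
have {}cd : dlsubmx M = - (drsubmx M *m one) by apply/eqP; rewrite -addr_eq0.
split.
  rewrite -[usubmx M]hsubmxK -/(ulsubmx M) -/(ursubmx M) ab.
  by rewrite mul_mx_row mulmx1 mulmxN.
rewrite -{1}[M]submxK mul_row_block !mul1mx ab cd /deflate -/one mul_mx_row mulmx1.
congr row_mx; first by rewrite mulmxN mulNmx opprK mulmxN mulmxBl opprB mulmxA.
by rewrite mulNmx addrC.
Qed.

(** [T], which keeps the first coordinate and takes the differences of the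
    others, conjugates [M] to the block triangular [N]. *)
Lemma char_poly_deflate (M : 'M[K]_(1 + n)) :
  M *m const_mx 1 = 0 :> 'cV[K]_(1 + n) ->
  char_poly M = 'X * char_poly (deflate M).
Proof.
move=> /deflateE[top bottom].
pose T : 'M[K]_(1 + n) := col_mx (row_mx 1%:M 0) differences.
pose N : 'M[K]_(1 + n) := block_mx 0 (ursubmx M) 0 (deflate M).
have TM : T *m M = N *m T.
  rewrite mul_col_mx bottom -{1}[M](@vsubmxK _ 1 n) mul_row_col.
  rewrite mul1mx mul0mx addr0 top.
  by rewrite mul_block_col !mul0mx !add0r.
pose Tp := map_mx (@polyC K) T.
have Tpdet : \det Tp = 1.
  by rewrite det_map_mx (det_lblock (1%:M : 'M[K]_1)) !det1 mulr1 rmorph1.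
have TpM : Tp *m char_poly_mx M = char_poly_mx N *m Tp.
  by rewrite /char_poly_mx mulmxBr mulmxBl scalar_mxC -!map_mxM TM.
have := congr1 determinant TpM; rewrite !det_mulmx Tpdet mul1r mulr1.
rewrite -/(char_poly M) => ->.
have -> : char_poly_mx N =
    block_mx 'X%:M (- map_mx (@polyC K) (ursubmx M))
             0 (char_poly_mx (deflate M)).
  rewrite /char_poly_mx /N map_block_mx/= !map_mx0 scalar_mx_block.
  by rewrite opp_block_mx add_block_mx ?oppr0 ?addr0 ?add0r.
by rewrite det_ublock det_scalar1.
Qed.

Lemma char_poly_tr (M : 'M[K]_n) : char_poly M^T = char_poly M.
Proof.
rewrite /char_poly -det_tr; congr (\det _); apply/matrixP => i j.
by rewrite !mxE eq_sym.
Qed.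

End Deflation.

Section Spectrum.
Variable R : realType.

Lemma spectrumE n (M : 'M[R]_n) :
  char_poly (complex_mx M) = \prod_(z <- spectrum M) ('X - z%:P).
Proof.
rewrite /spectrum; case: closed_field_poly_normal => zs /= e.
rewrite [LHS]e (monicP (char_poly_monic _)) scale1r.
by apply: perm_big; rewrite perm_sym; apply/permPl/perm_sort.
Qed.

Lemma spectrum_sorted n (M : 'M[R]_n) :
  sorted (fun z w : R[i] => complex.Re z <= complex.Re w) (spectrum M).
Proof. by apply: sort_sorted => z w; exact: le_total. Qed.

(** If 0 has the least real part, removing it from the list leaves the second
    smallest real part as a lower bound; the case where another value of null
    real part is sorted first is harmless. *)
Lemma sorted_second (s zs : seq R[i]) :
  sorted (fun z w : R[i] => complex.Re z <= complex.Re w) s ->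
  perm_eq s (0 :: zs) -> (forall z, z \in zs -> 0 <= complex.Re z) ->
  0 <= complex.Re (nth 0 s 1) /\
  (forall z, z \in zs -> complex.Re (nth 0 s 1) <= complex.Re z).
Proof.
case: s => [|x [|y s]] ss ps zs0.
- by have := perm_size ps.
- by have := perm_size ps; case: zs {ps zs0} => //= _; split => //; rewrite lexx.
have ymin z : z \in y :: s -> complex.Re y <= complex.Re z.
  move: ss => /= /andP[_]; rewrite inE => ys /predU1P[->//|].
  have tr : transitive (fun z w : R[i] => complex.Re z <= complex.Re w).
    by move=> ? ? ?; exact: le_trans.
  by have /allP := order_path_min tr ys; apply.
split=> /=.
  have : y \in 0 :: zs by rewrite -(perm_mem ps) !inE eqxx orbT.
  by rewrite inE => /predU1P[->//=|/zs0//]; rewrite lexx.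
move=> z zzs; have [x0|x0] := eqVneq x 0.
  by apply: ymin; move: ps; rewrite x0 perm_cons => /perm_mem ->.
apply: le_trans (zs0 z zzs); apply: (ymin 0).
have : 0 \in x :: y :: s by rewrite (perm_mem ps) inE eqxx.
by rewrite inE eq_sym (negbTE x0).
Qed.

(** The squared modulus as a real number, hence in a totally ordered field. *)
Let nsq (x : R[i]) : R := complex.Re x ^+ 2 + complex.Im x ^+ 2.

Let nsqM (x y : R[i]) : nsq (x * y) = nsq x * nsq y.
Proof. by case: x y => [x1 x2] [y1 y2]; rewrite /nsq /=; ring. Qed.

Let nsq_gt0 (x : R[i]) : x != 0 -> 0 < nsq x.
Proof.
case: x => [x1 x2]; rewrite eq_complex /= negb_and /nsq /= => /orP[h|h].
  by rewrite ltr_pwDl ?sqr_ge0// exprn_even_gt0.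
by rewrite ltr_wpDl ?sqr_ge0// exprn_even_gt0.
Qed.

(** Gershgorin's argument at a coordinate [i] of maximal modulus of an
    eigenvector [v]: dividing by [v_i], the other coordinates have real part at
    most 1, and the [i]-th row gives [Re z >= \sum_j M i j = 0]. *)
Lemma gershgorin_Re n (M : 'M[R]_n) (z : R[i]) :
  (forall i j, i != j -> M i j <= 0) -> (forall i, \sum_j M i j = 0) ->
  root (char_poly (complex_mx M)) z -> 0 <= complex.Re z.
Proof.
(* The row eigenvectors of the transpose are the column eigenvectors of [M]. *)
move=> Mle0 Msum; rewrite -char_poly_tr -eigenvalue_root_char.
move=> /eigenvalueP[v vM v0].
have [/forallP vk0|/forallPn[k vk]] := boolP [forall k, v 0 k == 0].
  by case/eqP: v0; apply/rowP => k; rewrite mxE; apply/eqP.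
pose i := [arg max_(i > k) nsq (v 0 i)]%O.
have imax j : nsq (v 0 j) <= nsq (v 0 i).
  by rewrite /i; case: arg_maxP => // l _; apply.
have vi : v 0 i != 0.
  apply/negP => /eqP vi; have := imax k; rewrite vi leNgt.
  by rewrite {1}/nsq /= expr0n addr0 nsq_gt0.
pose w j := v 0 j / v 0 i.
have wle1 j : complex.Re (w j) <= 1.
  have : nsq (w j) <= 1.
    rewrite -(ler_pM2r (nsq_gt0 vi)) -nsqM /w divfK// mul1r; exact: imax.
  by rewrite /nsq; nra.
have zE : z = \sum_j (M i j)%:C%C * w j.
  have /(congr1 (fun x => x / v 0 i)) := congr1 (fun u : 'rV__ => u 0 i) vM.
  rewrite !mxE mulfK// => <-; rewrite mulr_suml; apply: eq_bigr => j _.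
  by rewrite !mxE /w mulrA [v 0 j * _]mulrC.
have ReD (x y : R[i]) : complex.Re (x + y) = complex.Re x + complex.Re y.
  by case: x y => [? ?] [? ?].
rewrite zE (big_morph _ ReD erefl) -(Msum i); apply: ler_sum => j _.
have -> : complex.Re ((M i j)%:C%C * w j) = M i j * complex.Re (w j).
  by case: (w j) => x y /=; rewrite mul0r subr0.
have [<-|/Mle0 Mij] := eqVneq i j.
  by rewrite /w divff//= mulr1.
by rewrite -[leLHS]mulr1 ler_wnM2l.
Qed.

End Spectrum.

Section Laplacian.
Variables (R : realType) (n : nat) (E : rel 'I_n).
Hypothesis E_noloop : irreflexive E.

Lemma laplacian_row_sum i : \sum_j laplacian R E i j = 0.
Proof.
rewrite (bigD1 i)//= mxE eqxx (bigD1 i)//= mxE E_noloop add0r.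
rewrite -big_split big1//= => j ji; rewrite !mxE.
by rewrite eq_sym (negbTE ji) subrr.
Qed.

Lemma laplacian_offdiag i j : i != j -> laplacian R E i j <= 0.
Proof. by move=> /negbTE ij; rewrite !mxE ij oppr_le0 ler0n. Qed.

Lemma laplacian_diag_le i : laplacian R E i i <= lmax R E.
Proof. exact: (le_bigmax _ (fun i => laplacian R E i i)). Qed.

End Laplacian.

(** The spectrum of the Laplacian is 0 followed by that of its deflation, and by
    Gershgorin's argument all real parts are nonnegative. If the
    eigenvalue 0 is multiple then [re_lambda2] is 0, still a lower bound. *)
Lemma deflated_laplacian_spectrum (R : realType) n (E : rel 'I_(1 + n)) :
  irreflexive E ->
  0 <= re_lambda2 R E /\
  exists2 zs : seq R[i],
    char_poly (complex_mx (deflate (laplacian R E))) =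
      \prod_(z <- zs) ('X - z%:P)
    & forall z, z \in zs -> re_lambda2 R E <= complex.Re z.
Proof.
move=> E_noloop; set L := laplacian R E.
pose zs := spectrum (deflate L).
have charL : \prod_(z <- spectrum L) ('X - z%:P) =
    \prod_(z <- 0 :: zs) ('X - z%:P).
  rewrite -spectrumE big_cons -spectrumE subr0 char_poly_deflate.
    rewrite /deflate /complex_mx map_mxB map_mxM map_const_mx rmorph1.
    by rewrite map_drsubmx map_ursubmx.
  rewrite (_ : const_mx 1 = map_mx (real_complex R) (const_mx 1)); last first.
    by rewrite map_const_mx rmorph1.
  rewrite -map_mxM (_ : L *m _ = 0) ?map_mx0//; apply/colP => i; rewrite mxE.
  under eq_bigr do rewrite [const_mx _ _ _]mxE mulr1.
  by rewrite laplacian_row_sum// mxE.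
have [|l0 lmin] := sorted_second (spectrum_sorted L) (prod_XsubC_eq charL).
  move=> z zzs; apply: (@gershgorin_Re _ _ L).
  - by move=> i j; exact: laplacian_offdiag.
  - exact: laplacian_row_sum.
  - by rewrite spectrumE charL root_prod_XsubC inE zzs orbT.
by split=> //; exists zs => //; exact: spectrumE.
Qed.

(** * The closed loop *)

Section ClosedLoop.
Variables (R : realType) (n r m p : nat) (E : rel 'I_n).
Variables (A : 'M[R]_r) (B : 'M[R]_(r, m)) (C : 'M[R]_(p, r)).
Variables (K : 'M[R]_(m, r)) (L : 'M[R]_(r, p)).
Variable x : 'I_n -> R -> 'cV[R]_(r + r).
Hypothesis E_noloop : irreflexive E.
Hypothesis x_sol : closed_loop_solution E A B C K L x.

Let G := L *m C.

Lemma evolves_mx_of_solution k l (y dy : R -> 'M[R]_(k, l)) :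
  {within [set t : R | 0 <= t], continuous y} ->
  (forall t : R, 0 < t -> is_derive t (1 : R) y (dy t)) -> evolves_mx y dy.
Proof.
move=> cy hy i j; split=> [s|t t0].
  apply: (@cvg_comp _ _ _ y (fun M : 'M[R]_(k, l) => M i j) _ _ _ (cy s)).
  exact: coord_continuous.
have [d e] := hy t t0; apply: DeriveDef; first by have /derivable_mxP := d; apply.
by move: e; rewrite (derive_mx d) => /matrixP/(_ i j); rewrite mxE.
Qed.

Lemma laplacian_mul (f : 'I_n -> R) i :
  \sum_j adjacency R E i j * (f j - f i) = - \sum_j laplacian R E i j * f j.
Proof.
rewrite (bigD1 i)//= subrr mulr0 add0r [in RHS](bigD1 i)//=.
rewrite [laplacian _ _ _ _]mxE eqxx.
have -> : \sum_k adjacency R E i k = \sum_(k | k != i) adjacency R E i k.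
  by rewrite (bigD1 i)//= [adjacency _ _ _ _]mxE E_noloop add0r.
rewrite opprD mulr_suml -!sumrN -big_split/=.
apply: eq_bigr => j ji; rewrite [laplacian _ _ _ _]mxE eq_sym (negbTE ji).
by ring.
Qed.

Lemma solution_evolves i : evolves_mx (x i) (fun t =>
  aug_A A B K *m x i t - block_mx 0 0 0 G *m \sum_j laplacian R E i j *: x j t).
Proof.
have [cx hx] := x_sol i.
apply: evolves_mx_ext (evolves_mx_of_solution cx hx) => // t _.
congr (_ + _); rewrite -mulmxN.
rewrite /aug_B /aug_C mul_col_mx mul0mx mul1mx mul_col_row !mulmx0 mul0mx.
congr (_ *m _); apply/matrixP => a b; rewrite ord1 [RHS]mxE !summxE.
transitivity (\sum_j adjacency R E i j * (x j t a 0 - x i t a 0)).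
  by apply: eq_bigr => j _; rewrite [LHS]mxE; congr (_ * _); rewrite !mxE.
rewrite (laplacian_mul (fun j => x j t a 0)); congr (- _).
by apply: eq_bigr => j _; rewrite [RHS]mxE.
Qed.

Lemma error_evolves i : evolves_mx (fun t => dsubmx (x i t))
  (fun t => A *m dsubmx (x i t) - G *m \sum_j laplacian R E i j *: dsubmx (x j t)).
Proof.
move=> a b; apply: evolves_ext (solution_evolves i (rshift r a) b) => [t|t _].
  by rewrite mxE.
rewrite -{1}[x i t]vsubmxK -[\sum_j _ *: x j t]vsubmxK /aug_A !mul_block_col.
rewrite !mul0mx !add0r opp_col_mx add_col_mx col_mxEd.
by rewrite linear_sum; under [in LHS]eq_bigr do rewrite linearZ.
Qed.

Lemma state_evolves i : evolves_mx (fun t => usubmx (x i t))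
  (fun t => (A - B *m K) *m usubmx (x i t) + B *m K *m dsubmx (x i t)).
Proof.
move=> a b; apply: evolves_ext (solution_evolves i (lshift r a) b) => [t|t _].
  by rewrite mxE.
rewrite -{1}[x i t]vsubmxK -[\sum_j _ *: x j t]vsubmxK /aug_A !mul_block_col.
by rewrite !mul0mx addr0 opp_col_mx add_col_mx col_mxEu subr0.
Qed.

(** The states and errors of all agents form one Metzler system: the blocks
    coupling two agents are nonnegative multiples of [G], and the diagonal block
    of agent [i] subtracts from [A] the matrix [G] at most [lmax] times. *)
Lemma solution_nonneg :
  metzler (A - B *m K) -> nonneg_mx (B *m K) -> nonneg_mx G ->
  metzler (A - lmax R E *: G) ->
  (forall i, nonneg_mx (x i 0)) ->
  forall t, 0 <= t -> forall i, nonneg_mx (x i t).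
Proof.
move=> ABK BK G0 AG x0 t t0 i a b; rewrite ord1.
have zmx k l : (0 : 'M[R]_r) k l = 0 by rewrite mxE.
pose G' : 'M[R]_(r + r) := block_mx 0 0 0 G.
have G'0 : nonneg_mx G'.
  move=> k l; rewrite /G'.
  case: (split_ordP k) => k' ->; case: (split_ordP l) => l' ->;
    by rewrite ?(block_mxEul, block_mxEur, block_mxEdl, block_mxEdr) ?zmx ?lexx.
pose M (k l : 'I_n * 'I_(r + r)) :=
  (k.1 == l.1)%:R * aug_A A B K k.2 l.2 - laplacian R E k.1 l.1 * G' k.2 l.2.
have := @positive_system R ('I_n * 'I_(r + r))%type M (fun k t => x k.1 t k.2 0).
move=> /(_ _ _ _ t t0 (i, a)); apply.
- move=> [k a'] [l b']; rewrite /M /=.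
  have [->|kl _] := eqVneq k l; last first.
    by rewrite mul0r sub0r -mulNr mulr_ge0// oppr_ge0 laplacian_offdiag.
  rewrite xpair_eqE eqxx mul1r /= => ab'.
  move: ab'; rewrite /aug_A /G'.
  case: (split_ordP a') => {}a' ->; case: (split_ordP b') => {}b' ->;
    rewrite ?(block_mxEul, block_mxEur, block_mxEdl, block_mxEdr) ?zmx;
    rewrite ?mulr0 ?subr0 => ab'.
  + by apply: ABK; apply: contra_neq ab' => ->.
  + exact: BK.
  + by [].
  + have /AG : a' != b' by apply: contra_neq ab' => ->.
    have -> : (A - lmax R E *: G) a' b' = A a' b' - lmax R E * G a' b'.
      by rewrite !mxE.
    move=> /le_trans; apply.
    by rewrite lerD2l lerN2 ler_wpM2r//; exact: laplacian_diag_le.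
- move=> [k a'] /=; apply: evolves_ext (solution_evolves k a' 0) => // s _.
  rewrite -(pair_bigA _ (fun l b' => M (k, a') (l, b') * x l s b' 0)) /= /M /=.
  transitivity (\sum_l \sum_b ((k == l)%:R * (aug_A A B K a' b * x l s b 0)
      - G' a' b * (laplacian R E k l * x l s b 0))); last first.
    by apply: eq_bigr => l _; apply: eq_bigr => b' _; ring.
  under [RHS]eq_bigr do rewrite sumrB.
  rewrite sumrB [LHS]mxE; congr (_ + _).
    rewrite (bigD1 k)//= [X in _ = _ + X]big1 ?addr0; last first.
      by move=> l lk; apply: big1 => b' _; rewrite eq_sym (negbTE lk) mul0r.
    by rewrite mxE; apply: eq_bigr => b' _; rewrite eqxx mul1r.
  rewrite [LHS]mxE; congr (- _); rewrite mxE exchange_big; apply: eq_bigr => b' _.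
  by rewrite summxE mulr_sumr; apply: eq_bigr => l _; congr (_ * _); rewrite mxE.
- by move=> k; exact: x0.
Qed.

End ClosedLoop.

(** * Consensus *)

Section Consensus.
Variable R : realType.

Lemma vanishes_cvg k l (y : R -> 'M[R]_(k, l)) :
  vanishes y -> y t @[t --> +oo] --> (0 : 'M[R]_(k, l)).
Proof.
move=> hy; apply/cvg_ballP => e e0.
have h i : \forall t \near +oo, forall j, ball ((0 : 'M[R]_(k, l)) i j) e (y t i j).
  apply: filter_forall => j; rewrite mxE.
  by have /cvg_ballP := hy i j; apply.
apply: filterS (filter_forall _ h) => t ht.
by split.
Qed.

(** Completing the square: with [W = C^T Q C] and [G = P W], the inequality
    [(P - X) W (P - X) >= 0] bounds [P W X + X W P - X W X] by [P W P], and
    raising the coefficient of [P W P] from [mu] to [a] only decreases the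
    form. *)
Lemma lmi_admissible r p (A P X : 'M[R]_r) (C : 'M[R]_(p, r)) (Q : 'M[R]_p)
    (mu a : R) :
  posdef P -> posdef Q -> posdef X -> 0 <= mu -> mu <= a ->
  negdef (P *m A^T + A *m P
          - (2 * mu) *: (P *m C^T *m Q *m C *m X)
          - (2 * mu) *: (X *m C^T *m Q *m C *m P)
          + (2 * mu) *: (X *m C^T *m Q *m C *m X)) ->
  admissible A (P *m C^T *m Q *m C) P a.
Proof.
move=> [PT _] Qp [XT _] mu0 mua; set H := _ + _ => -[_ Hn].
have [QT _] := Qp.
set G := P *m C^T *m Q *m C.
have GPT : P *m G^T = G *m P.
  by rewrite /G !trmx_mul trmxK PT QT !mulmxA.
pose sq (Y : 'M[R]_r) := (C *m Y)^T *m Q *m (C *m Y).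
have E : (A - a *: G) *m P + P *m (A - a *: G)^T =
    H - (2 * (a - mu)) *: sq P - (2 * mu) *: sq (P - X).
  have -> : (A - a *: G)^T = A^T - a *: G^T by rewrite linearB linearZ.
  rewrite mulmxBl mulmxBr -scalemxAl -scalemxAr GPT.
  have -> : sq P = G *m P by rewrite /sq trmx_mul PT !mulmxA.
  have -> : sq (P - X) =
      G *m P - G *m X - X *m C^T *m Q *m C *m P + X *m C^T *m Q *m C *m X.
    have PXT : (P - X)^T = P - X by rewrite linearB /= PT XT.
    rewrite /sq trmx_mul PXT !(mulmxBl, mulmxBr) !mulmxA -/G.
    by rewrite opprB [X in _ + X = _]addrC addrA.
  rewrite /H -/G; move: (G *m P) (G *m X).
  move: (X *m C^T *m Q *m C *m P) (X *m C^T *m Q *m C *m X).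
  move: (A *m P) (P *m A^T) => ? ? ? ? ? ?.
  by apply/matrixP => i j; rewrite !mxE; ring.
split=> [|v v0].
  by rewrite linearD/= !trmx_mul !trmxK PT addrC.
have sq0 Y : 0 <= bform (sq Y) v v.
  by rewrite /sq -bform_congr; exact: posdef_ge0.
have := Hn v v0; rewrite E -!/(bform _ v v).
have -> : bform (H - (2 * (a - mu)) *: sq P - (2 * mu) *: sq (P - X)) v v =
    bform H v v - 2 * (a - mu) * bform (sq P) v v
    - 2 * mu * bform (sq (P - X)) v v.
  by rewrite /bform !(mulmxBr, mulmxBl) -!scalemxAr -!scalemxAl !mxE.
apply: le_lt_trans; rewrite -addrA gerDl.
have h1 : 0 <= 2 * (a - mu) * bform (sq P) v v.
  by rewrite !mulr_ge0// subr_ge0.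
have h2 : 0 <= 2 * mu * bform (sq (P - X)) v v by rewrite !mulr_ge0.
lra.
Qed.

(** Collect the errors as the columns of [e]. The differences [F] with the error
    of the first agent solve [F' = A F - G F N] on their own, where [N] is the
    transposed deflation of the Laplacian, whose eigenvalues are all
    admissible. *)
Lemma error_consensus n r m p (E : rel 'I_(1 + n.+1)) (A P : 'M[R]_r)
    (B : 'M[R]_(r, m)) (C : 'M[R]_(p, r)) (K : 'M[R]_(m, r)) (L : 'M[R]_(r, p))
    x :
  irreflexive E -> closed_loop_solution E A B C K L x ->
  posdef P -> (L *m C *m P)^T = L *m C *m P ->
  (forall a, re_lambda2 R E <= a -> admissible A (L *m C) P a) ->
  forall i j, vanishes (fun t => dsubmx (x j t) - dsubmx (x i t)).
Proof.
move=> E_noloop x_sol Pp GP adm.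
set G := L *m C in GP adm; pose Lap := laplacian R E.
pose e (t : R) : 'M[R]_(r, 1 + n.+1) := \matrix_(a, i) dsubmx (x i t) a 0.
have ev : evolves_mx e (fun t => A *m e t - G *m e t *m Lap^T).
  move=> a i; apply: evolves_ext (error_evolves E_noloop x_sol i a 0) => [t|t _].
    by rewrite [RHS]mxE.
  rewrite -[G *m _ *m _]mulmxA !mxE -/G; congr (_ - _).
    by apply: eq_bigr => b _; rewrite [e _ _ _]mxE.
  apply: eq_bigr => b _; congr (_ * _).
  rewrite summxE [RHS]mxE; apply: eq_bigr => j _.
  by rewrite mxE [e _ _ _]mxE [Lap^T _ _]mxE mulrC.
have lap1 : Lap *m const_mx 1 = 0 :> 'cV_(1 + n.+1).
  apply/colP => i; rewrite mxE; under eq_bigr do rewrite [const_mx _ _ _]mxE mulr1.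
  by rewrite laplacian_row_sum// mxE.
have [_ bottom] := deflateE lap1.
pose Dt : 'M[R]_(1 + n.+1, n.+1) := (differences R n.+1)^T.
have LD : Lap^T *m Dt = Dt *m (deflate Lap)^T by rewrite -!trmx_mul bottom.
have evF : evolves_mx (fun t => e t *m Dt)
    (fun t => A *m (e t *m Dt) - G *m (e t *m Dt) *m (deflate Lap)^T).
  apply: evolves_mx_ext (evolves_mulmxr Dt ev) => // t _.
  by rewrite mulmxBl -!mulmxA LD.
have [_ [zs charL zsmin]] := deflated_laplacian_spectrum R E_noloop.
have vF : vanishes (fun t => e t *m Dt).
  apply: (vanishes_of_spectrum Pp GP evF (zs := zs)).
    by rewrite -charL /complex_mx -map_trmx char_poly_tr.
  by move=> z /zsmin; exact: adm.
have v0 i : vanishes (fun t => dsubmx (x i t) - dsubmx (x ord0 t)).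
  move=> a b; case: (split_ordP i) => k ->.
    rewrite (_ : lshift n.+1 k = ord0); last by apply/val_inj; rewrite /= ord1.
    under eq_fun do rewrite subrr mxE.
    exact: cvg_cst.
  suff <- : (fun t => (e t *m Dt) a k) =
      (fun t => (dsubmx (x (rshift 1 k) t) - dsubmx (x ord0 t)) a b) by exact: vF.
  apply/funext => t.
  rewrite /Dt /differences tr_row_mx -[e t](@hsubmxK _ _ 1 n.+1).
  rewrite mul_row_col trmx1 mulmx1.
  rewrite [LHS]mxE [X in X + _]mxE big_ord1 addrC !mxE ord1 mulrN mulr1.
  by rewrite (ord1 b) (_ : lshift n.+1 0 = ord0) //; exact: val_inj.
move=> i j; have := vanishesD (v0 j) (vanishes_mulmxl (- 1%:M) (v0 i)).
by apply: vanishes_ext => t; rewrite mulNmx mul1mx opprB addrA subrK.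
Qed.
End Consensus.

Theorem theorem3 (R : realType) (n r m p : nat)
    (hn : (2 <= n)%N)
    (E : rel 'I_n)
    (E_noloop : irreflexive E)
    (E_tree : has_spanning_tree E)
    (A : 'M[R]_r) (B : 'M[R]_(r, m)) (C : 'M[R]_(p, r))
    (A_metzler : metzler A)
    (B_ge0 : nonneg_mx B)
    (C_ge0 : nonneg_mx C)
    (AB_stab : stabilizable A B)
    (AC_detect : detectable A C)
    (D : 'M[R]_r) (P : 'M[R]_r) (Q : 'M[R]_p) (X : 'M[R]_r) (S : 'M[R]_(m, r))
    (D_diag : is_diag_mx D)
    (D_pos : posdef D)
    (P_pos : posdef P)
    (Q_pos : posdef Q)
    (X_pos : posdef X)
    (h1 : negdef (P *m A^T + A *m P
                  - (2 * re_lambda2 R E) *: (P *m C^T *m Q *m C *m X)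
                  - (2 * re_lambda2 R E) *: (X *m C^T *m Q *m C *m P)
                  + (2 * re_lambda2 R E) *: (X *m C^T *m Q *m C *m X)))
    (h2 : metzler (A - lmax R E *: (P *m C^T *m Q *m C)))
    (h3 : nonneg_mx (P *m C^T *m Q *m C))
    (h4 : nonneg_mx (B *m S))
    (h5 : metzler (A *m D - B *m S))
    (h6 : negdef (A *m D - B *m S + D *m A^T - S^T *m B^T)) :
  PCDMAS_solvable E A B C /\
  solves_PCDMAS E A B C (S *m invmx D) (P *m C^T *m Q).
Proof.
set K := S *m invmx D; set L := P *m C^T *m Q.
suff sol : solves_PCDMAS E A B C K L by split=> //; exists K, L.
move=> x x_sol x0.
have [d Dd] : exists d, D = diag_mx d by apply/diag_mxP.
have d_gt0 i : 0 < d 0 i.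
  have [_ /(_ (delta_mx i 0))] := D_pos.
  rewrite trmx_delta -rowE -colE !mxE Dd mxE eqxx.
  apply; apply/eqP => /matrixP/(_ i 0); rewrite !mxE !eqxx => /eqP.
  by rewrite oner_eq0.
have KD : K *m D = S by rewrite /K mulmxKV// posdef_unit.
have DT : D^T = D by case: D_pos.
(* Signs of entries are read off after right multiplication by [D]. *)
have colD k (M : 'M[R]_(k, r)) i j : M i j * d 0 j = (M *m D) i j.
  by rewrite Dd mul_mx_diag mxE.
have BK_ge0 : nonneg_mx (B *m K).
  by move=> i j; rewrite -(pmulr_lge0 _ (d_gt0 j)) colD -mulmxA KD.
have ABK_metzler : metzler (A - B *m K).
  move=> i j ij; rewrite -(pmulr_lge0 _ (d_gt0 j)) colD mulmxBl -mulmxA KD.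
  exact: h5.
have LC_P : (L *m C *m P)^T = L *m C *m P.
  have [PT _] := P_pos; have [QT _] := Q_pos.
  by rewrite /L !trmx_mul trmxK PT QT !mulmxA.
split; last exact: solution_nonneg E_noloop x_sol ABK_metzler BK_ge0 h3 h2 x0.
move=> i j.
case: n hn E E_noloop E_tree h1 h2 x x_sol x0 i j => [|[|n']]//.
move=> _ E' noloop _ h1' _ x x_sol _ i j.
have [mu_ge0 _] := deflated_laplacian_spectrum R noloop.
have verr : vanishes (fun t => dsubmx (x j t) - dsubmx (x i t)).
  apply: (error_consensus noloop x_sol P_pos LC_P) => a mua.
  exact: lmi_admissible P_pos Q_pos X_pos mu_ge0 mua h1'.
have vstate : vanishes (fun t => usubmx (x j t) - usubmx (x i t)).
  apply: (lyapunov_vanishes D_pos (M := A - B *m K)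
    (w := fun t => B *m K *m (dsubmx (x j t) - dsubmx (x i t)))).
  - have ABKD : (A - B *m K) *m D = A *m D - B *m S by rewrite mulmxBl -mulmxA KD.
    by rewrite -{2}DT -trmx_mul ABKD linearB/= !trmx_mul DT addrA.
  - apply: evolves_mx_ext (evolves_mxD (state_evolves noloop x_sol j)
      (evolves_mulmxl (- 1%:M) (state_evolves noloop x_sol i))) => t.
      by rewrite mulNmx mul1mx.
    by move=> _; rewrite mulNmx mul1mx !mulmxBr opprD addrACA.
  - exact: vanishes_mulmxl.
apply: vanishes_cvg => a b; case: (split_ordP a) => k ->.
  suff <- : (fun t => (usubmx (x j t) - usubmx (x i t)) k b) =
      (fun t => (x j t - x i t) (lshift r k) b) by exact: vstate.
  by apply/funext => t; rewrite !mxE.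
suff <- : (fun t => (dsubmx (x j t) - dsubmx (x i t)) k b) =
    (fun t => (x j t - x i t) (rshift r k) b) by exact: verr.
by apply/funext => t; rewrite !mxE.
Qed.
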